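(* Let $k$ be an algebraically closed field of characteristic $0$, let $N\geq 1$, $n\geq 1$ be integers, and let $P_1,\ldots,P_n$ be $n$ generic points in $\mathbb{P}^N_{k(\underline z)}$. Let $H=\bigcap_{i=1}^n I(P_i)\subseteq S=k(\underline z)[x_0,\ldots,x_N]$. Then for all $m\geq 1$ $$\frac{\alpha(H^{(m)})}{m}\geq \frac{\alpha(H)+N-1}{N}.$$
   Context: Generic points: $k(\underline z)$ is the purely transcendental extension of $k$ obtained by adjoining $n(N+1)$ variables $\underline z=(z_{ij})$, $1\le i\le n$, $0\le j\le N$. The $n$ generic points are $P_i=[z_{i0}:z_{i1}:\cdots:z_{iN}]\in\mathbb{P}^N_{k(\underline z)}$, $1\le i\le n$, and $I(P_i)\subseteq S=k(\underline z)[x_0,\ldots,x_N]$ is the homogeneous ideal defining $P_i$. For a homogeneous ideal $J$ of $S$: $\alpha(J)$ is the least degree of a nonzero homogeneous polynomial in $J$, and $J^{(m)}=\bigcap_{p}(J^mS_p\cap S)$, where $p$ runs over all associated primes of $S/J$ (so $H^{(m)}=\bigcap_i I(P_i)^m$). *)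

(* Defs.v *)
From mathcomp Require Import all_boot all_order all_algebra.
From mathcomp Require Import boolp classical_sets.
From mathcomp Require Import mpoly.

Set Implicit Arguments.
Unset Strict Implicit.
Unset Printing Implicit Defensive.

Import Order.TTheory GRing.Theory Num.Theory.
Local Open Scope ring_scope.
Local Open Scope classical_set_scope.

Local Notation "x %:F" := (tofrac x).

Definition ideal_gen (R : comNzRingType) (A : set R) : set R :=
  [set x | exists (r : nat) (c a : 'I_r -> R),
      (forall t, A (a t)) /\ x = \sum_(t < r) c t * a t].

Definition ideal_exp (R : comNzRingType) (J : set R) (m : nat) : set R :=
  ideal_gen [set x | exists a : 'I_m -> R,
      (forall t, J (a t)) /\ x = \prod_(t < m) a t].

(* [idealr_closed] includes properness ([1 \notin p]). *)
Definition prime_ideal (R : comNzRingType) (p : set R) : Prop :=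
  idealr_closed (mem p) /\ prime_idealr_closed (mem p).

(* [p] is an associated prime of [R / J]: a prime ideal which is the
   annihilator of the class of some [f]. *)
Definition associated_prime (R : comNzRingType) (J p : set R) : Prop :=
  prime_ideal p /\ exists f : R, p = [set g | J (g * f)].

(* The localization [R_p] of the domain [R], as a subring of its fraction
   field. *)
Definition localization (R : idomainType) (p : set R) : set {fraction R} :=
  [set x | exists a s : R, ~ p s /\ x = a%:F / s%:F].

(* The extension [J R_p], i.e. the [R_p]-submodule of the fraction field
   generated by [J]. *)
Definition localized_ideal (R : idomainType) (p J : set R) :
    set {fraction R} :=
  [set x | exists (r : nat) (c : 'I_r -> {fraction R}) (a : 'I_r -> R),
      [/\ forall t, localization p (c t), forall t, J (a t)
        & x = \sum_(t < r) c t * (a t)%:F]].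

Definition symbolic_power (R : idomainType) (J : set R) (m : nat) : set R :=
  [set f | forall p : set R, associated_prime J p ->
      localized_ideal p (ideal_exp J m) f%:F].

(* The point is given by homogeneous coordinates [P 0, ..., P N]. *)
Definition point_ideal (K : fieldType) (N : nat) (P : 'I_N.+1 -> K) :
    set {mpoly K[N.+1]} :=
  ideal_gen [set f | (exists d : nat, f \is d.-homog) /\ f.@[P] = 0].

(* [alpha J] takes the junk value 0 when [J] has no nonzero homogeneous
   element. *)
Definition alpha (K : fieldType) (n : nat) (J : set {mpoly K[n]}) : nat :=
  let deg := [set d : nat | exists f : {mpoly K[n]},
      [/\ J f, f != 0 & f \is d.-homog]] in
  xget 0%N [set d | deg d /\ forall e, deg e -> (d <= e)%N].

(* The variable [z_ij] is the one of index [mxvec_index i j], which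
   identifies ['I_n * 'I_N.+1] with ['I_(n * N.+1)]. *)
Definition generic_point (k : fieldType) (n N : nat) (i : 'I_n) :
    'I_N.+1 -> {fraction {mpoly k[n * N.+1]}} :=
  fun j => ('X_(mxvec_index i j))%:F.

Definition generic_points_ideal (k : fieldType) (n N : nat) :
    set {mpoly {fraction {mpoly k[n * N.+1]}}[N.+1]} :=
  \bigcap_(i in [set: 'I_n]) point_ideal (@generic_point k n N i).

Arguments generic_points_ideal k n N : clear implicits.

(* Main.v *)
From HB Require Import structures.
Require Import Defs.
From mathcomp Require Import all_boot all_order all_algebra.
From mathcomp Require Import boolp classical_sets.
From mathcomp Require Import mpoly zify ring.

(* Choose [b] with ['C(b + N, N) <= n < 'C(b + 1 + N, N)].  Counting forms gives
   [alpha H <= b + 1], so it suffices that [alpha (H^(m)) >= m (b + N) / N].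
   Vanishing to order [m] at the [n] points is a linear system on forms of a
   given degree, whose rank can only drop under specialization; so a nonzero
   form in [H^(m)] yields one of the same degree over [k] that vanishes to order
   [m] at the ['C(b + N, N)] points of a star configuration, the [N]-fold
   intersections of [b + N] general hyperplanes.  There the bound is elementary:
   a form of smaller degree vanishes on every hyperplane, by induction on [N],
   hence is divisible by their product, and one descends on the degree. *)

Import Order.TTheory GRing.Theory Num.Theory.
Local Open Scope ring_scope.

Set Implicit Arguments.
Unset Strict Implicit.
Unset Printing Implicit Defensive.

(** * Rank semicontinuity *)

(* An invertible maximal minor of the specialized rows is already invertible
   before specialization. *)
Lemma kernel_specialize (R : idomainType) (k : fieldType)
    (pi : {rmorphism R -> k}) (I : Type) (D : nat) (r : I -> 'rV[R]_D)
    (c : 'cV[{fraction R}]_D) :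
  c != 0 -> (forall i, map_mx (@tofrac R) (r i) *m c = 0) ->
  exists2 c0 : 'cV[k]_D, c0 != 0 & forall i, map_mx pi (r i) *m c0 = 0.
Proof.
move=> c_neq0 rc0.
pose A q (f : 'I_q -> I) := \matrix_(a < q) r (f a).
(* The index type may be infinite, so a maximal finite selection of rows that are independent after
   specialization is taken. *)
pose P q := `[< exists f : 'I_q -> I, row_free (map_mx pi (A q f)) >].
have exP : exists q, P q.
  exists 0%N; apply/asboolP; have f : 'I_0 -> I by case.
  by exists f; rewrite /row_free -leqn0 rank_leq_row.
have leP q : P q -> (q <= D)%N.
  by case/asboolP=> f /eqP {1}<-; exact: rank_leq_col.
case: (ex_maxnP exP leP) => q /asboolP[f freeA] maxq.
(* If [q = D], the square minor has a nonzero determinant already over [R], which forces [c = 0]. *)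
have [eq_qD|neq_qD] := eqVneq q D.
  subst q; move: freeA; rewrite row_free_unit unitmxE det_map_mx unitfE => detA.
  have detA' : \det (A D f) != 0 by apply: contraNneq detA => ->; rewrite rmorph0.
  have unitA : map_mx (@tofrac R) (A D f) \in unitmx.
    by rewrite unitmxE det_map_mx unitfE tofrac_eq0.
  case/eqP: c_neq0; rewrite -(mulKmx unitA c).
  suff -> : map_mx (@tofrac R) (A D f) *m c = 0 by rewrite mulmx0.
  apply/row_matrixP => a; rewrite row_mul row0 -map_row rowK.
  exact: rc0.
have lt_qD : (q < D)%N.
  by rewrite ltn_neqAle neq_qD leP //; apply/asboolP; exists f.
set B := map_mx pi (A q f) in freeA.
(* For [q < D] a nonzero column of the cokernel kills the selected rows, and by maximality every
   other row lies in their span. *)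
have coker_neq0 : cokermx B != 0.
  by rewrite -mxrank_eq0 mxrank_coker (eqP freeA) subn_eq0 -ltnNge.
have [j colj] : exists j, col j (cokermx B) != 0.
  apply/existsP; apply: contraNT coker_neq0; rewrite negb_exists => /forallP h.
  by apply/eqP/matrixP => a b; move/negPn/eqP/matrixP/(_ a 0): (h b); rewrite !mxE.
exists (col j (cokermx B)) => // i.
suff: (map_mx pi (r i) <= B)%MS.
  by rewrite submxE colE mulmxA => /eqP ->; rewrite mul0mx.
apply: contraT => nsub.
suff /maxq : P (q + 1)%N by rewrite addn1 ltnn.
apply/asboolP.
exists (fun a => match split a with inl a' => f a' | inr _ => i end).
have -> : map_mx pi (A (q + 1)%N
    (fun a => match split a with inl a' => f a' | inr _ => i end)) =
    col_mx B (map_mx pi (r i)).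
  apply/matrixP => a b; rewrite !mxE.
  by case: (split a) => a'; rewrite !mxE ?ord1.
rewrite /row_free eqn_leq rank_leq_row -addsmxE addn1 -{1}(eqP freeA).
apply: rank_ltmx; rewrite ltmxE addsmxSl /=.
by apply: contra nsub; apply: submx_trans; exact: addsmxSr.
Qed.

(** * Order of vanishing along lines *)

Definition ord_ge (R : nzRingType) (m : nat) (p : {poly R}) : Prop :=
  forall j, (j < m)%N -> p`_j = 0.

Lemma ord_geM (R : nzRingType) (m n : nat) (p q : {poly R}) :
  ord_ge m p -> ord_ge n q -> ord_ge (m + n) (p * q).
Proof.
move=> hp hq j ltj; rewrite coefM big1 // => i _.
have [lti|lei] := ltnP i m; first by rewrite hp ?mul0r.
by rewrite hq ?mulr0 //; have := ltn_ord i; lia.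
Qed.

Lemma ord_ge_cancel (R : idomainType) (m : nat) (p q : {poly R}) :
  p`_0 != 0 -> ord_ge m (p * q) -> ord_ge m q.
Proof.
move=> p0 hpq j; elim/ltn_ind: j => j IH ltj.
have := hpq _ ltj; rewrite coefM big_ord_recl big1 ?addr0 => [|i _].
  by move/eqP; rewrite mulf_eq0 (negPf p0) subn0 => /eqP.
by rewrite lift0 IH ?mulr0 //; have := ltn_ord i; lia.
Qed.

Lemma ord_geD (R : nzRingType) (m : nat) (p q : {poly R}) :
  ord_ge m p -> ord_ge m q -> ord_ge m (p + q).
Proof. by move=> hp hq j ltj; rewrite coefD hp // hq // addr0. Qed.

Lemma ord_ge_mulr (R : comNzRingType) (m : nat) (p q : {poly R}) :
  ord_ge m q -> ord_ge m (p * q).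
Proof. by move=> hq; apply: (@ord_geM _ 0%N). Qed.

Lemma eq_mmap (n : nat) (R S : nzRingType) (f f' : R -> S)
    (h h' : 'I_n -> S) (p : {mpoly R[n]}) :
  f =1 f' -> h =1 h' -> mmap f h p = mmap f' h' p.
Proof.
move=> ef eh; apply: eq_bigr => m _; rewrite ef; congr (_ * _).
exact: mmap1_eq.
Qed.

Lemma rmorph_mmap1 (n : nat) (S T : comNzRingType) (g : {rmorphism S -> T})
    (h : 'I_n -> S) (m : 'X_{1..n}) : g (mmap1 h m) = mmap1 (g \o h) m.
Proof.
by rewrite rmorph_prod; apply: eq_bigr => i _; rewrite rmorphXn.
Qed.

Lemma rmorph_mmap (n : nat) (R : nzRingType) (S T : comNzRingType)
    (g : {rmorphism S -> T}) (f : R -> S) (h : 'I_n -> S) (p : {mpoly R[n]}) :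
  g (mmap f h p) = mmap (g \o f) (g \o h) p.
Proof.
rewrite rmorph_sum; apply: eq_bigr => m _.
by rewrite rmorphM rmorph_mmap1.
Qed.

Lemma mmap_comp (n l : nat) (R S : comNzRingType) (f : {rmorphism R -> S})
    (h : 'I_l -> S) (q : 'I_n -> {mpoly R[l]}) (p : {mpoly R[n]}) :
  mmap f h (mmap (@mpolyC _ R) q p) = mmap f (fun i => mmap f h (q i)) p.
Proof.
rewrite (rmorph_mmap (mmap f h)); apply: eq_mmap => // c /=.
exact: mmapC.
Qed.

(** The form along the line [P + X v]; the map [f] lets its coefficients lie in another ring than
    the coordinates of the point. *)
Definition line (n : nat) (R S : comNzRingType) (f : R -> S)
    (P v : 'I_n -> S) : {mpoly R[n]} -> {poly S} :=
  mmap (polyC \o f) (fun i => (P i)%:P + (v i)%:P * 'X).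

HB.instance Definition _ (n : nat) (R S : comNzRingType)
    (f : {rmorphism R -> S}) (P v : 'I_n -> S) :=
  GRing.RMorphism.copy (line f P v) (mmap (polyC \o f) _).

Lemma line_coef0 (n : nat) (R S : comNzRingType) (f : R -> S)
    (P v : 'I_n -> S) (F : {mpoly R[n]}) : (line f P v F)`_0 = mmap f P F.
Proof.
rewrite -horner_coef0 -/(horner_eval 0 _) rmorph_mmap.
by apply: eq_mmap => x /=; rewrite /horner_eval !hornerE.
Qed.

Lemma map_line (n : nat) (R S T : comNzRingType) (g : {rmorphism S -> T})
    (f : R -> S) (P v : 'I_n -> S) (F : {mpoly R[n]}) :
  map_poly g (line f P v F) = line (g \o f) (g \o P) (g \o v) F.
Proof.
rewrite /line (rmorph_mmap (map_poly g)); apply: eq_mmap => x /=.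
  by rewrite map_polyC.
by rewrite rmorphD rmorphM /= !map_polyC map_polyX.
Qed.

(** Over an infinite field this is membership in the [m]-th power of the maximal ideal of the affine
    point [P]. *)
Definition vanishes (n : nat) (k : comNzRingType) (m : nat) (P : 'I_n -> k)
    (F : {mpoly k[n]}) : Prop :=
  forall v : 'I_n -> k, ord_ge m (line idfun P v F).

(** A linear substitution carries lines to lines; [q'] is its action on points and on directions. *)
Lemma vanishes_mmap (n l : nat) (k : comNzRingType) (m : nat)
    (q : 'I_n -> {mpoly k[l]}) (q' : ('I_l -> k) -> 'I_n -> k)
    (P : 'I_l -> k) (F : {mpoly k[n]}) :
  (forall P v i, line idfun P v (q i) = (q' P i)%:P + (q' v i)%:P * 'X) ->
  vanishes m (q' P) F -> vanishes m P (mmap (@mpolyC _ _) q F).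
Proof.
move=> lineq vanF v; rewrite /line mmap_comp.
have := vanF (q' v); congr ord_ge; apply: eq_mmap => // i.
by rewrite -lineq.
Qed.

(** * Linear forms and division by them *)

Definition linear_form (n : nat) (k : nzRingType) (a : 'I_n -> k) :
  {mpoly k[n]} := \sum_i a i *: 'X_i.

Lemma mmap_linear_form (n : nat) (k : nzRingType) (S : comNzRingType)
    (f : {rmorphism k -> S}) (h : 'I_n -> S) (a : 'I_n -> k) :
  mmap f h (linear_form a) = \sum_i f (a i) * h i.
Proof.
rewrite raddf_sum; apply: eq_bigr => i _ /=.
by rewrite mmapZ mmapX mmap1U.
Qed.

Lemma linear_form_homog (n : nat) (k : nzRingType) (a : 'I_n -> k) :
  linear_form a \is 1.-homog.
Proof.
by apply: rpred_sum => i _; apply: rpredZ; rewrite dhomogX /= mdeg1.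
Qed.

Lemma line_linear_form (n : nat) (R S : comNzRingType)
    (f : {rmorphism R -> S}) (P v : 'I_n -> S) (a : 'I_n -> R) :
  line f P v (linear_form a) =
  (\sum_i f (a i) * P i)%:P + (\sum_i f (a i) * v i)%:P * 'X.
Proof.
rewrite /line (mmap_linear_form (polyC \o f)) !rmorph_sum mulr_suml -big_split.
by apply: eq_bigr => i _ /=; rewrite mulrDr !rmorphM /= mulrA.
Qed.

Lemma natr_inj_pchar0 (k : idomainType) :
  [pchar k] =i pred0 -> injective (fun i : nat => i%:R : k).
Proof.
move=> /pcharf0P natr_eq0 i j /eqP.
wlog le_ij : i j / (i <= j)%N.
  move=> W /eqP eq_ij; case/orP: (leq_total i j) => le_ij.
    by apply: W; rewrite ?eq_ij.
  by apply/esym/W; rewrite ?eq_ij.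
rewrite eq_sym -subr_eq0 -natrB // natr_eq0 subn_eq0 => le_ji.
by apply/eqP; rewrite eqn_leq le_ij.
Qed.

Lemma poly_eq0_horner (k : fieldType) (p : {poly k}) :
  [pchar k] =i pred0 -> (forall c, p.[c] = 0) -> p = 0.
Proof.
move=> char0 p0; apply/eqP/negPn/negP => p_neq0.
have uniq_s : uniq [seq i%:R : k | i <- iota 0 (size p)].
  by rewrite map_inj_uniq ?iota_uniq //; exact: natr_inj_pchar0.
have := max_poly_roots p_neq0 _ uniq_s.
rewrite size_map size_iota ltnn => h.
by apply: notF; apply: h; apply/allP => c _; rewrite rootE p0.
Qed.

(** Off the hyperplane, the linear form has a nonzero constant term along every line through [P] and
    can be cancelled. *)
Lemma vanishes_divl_neq0 (n : nat) (k : fieldType) (m : nat) (P a : 'I_n -> k)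
    (G : {mpoly k[n]}) :
  \sum_i a i * P i != 0 -> vanishes m P (linear_form a * G) -> vanishes m P G.
Proof.
move=> aP vanLG v; have := vanLG v; rewrite rmorphM /=; apply: ord_ge_cancel.
by rewrite line_coef0 mmap_linear_form.
Qed.

(* If [w] is transverse to the hyperplane, then for fixed [v] the coefficients
   of [G] along [P + X (v + c w)] are polynomials in [c] that vanish whenever
   [v + c w] is transverse too, hence identically. *)
Lemma vanishes_divl_eq0 (n : nat) (k : fieldType) (m : nat) (P a w : 'I_n -> k)
    (G : {mpoly k[n]}) :
  [pchar k] =i pred0 -> \sum_i a i * P i = 0 -> \sum_i a i * w i != 0 ->
  vanishes m P (linear_form a * G) -> vanishes m.-1 P G.
Proof.
move=> char0 aP aw vanLG v j ltj.
pose Q := line (@polyC k) (fun i => (P i)%:P) (fun i => (v i)%:P + (w i)%:P * 'X) G.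
have evQ c : map_poly (horner_eval c) Q = line idfun P (fun i => v i + w i * c) G.
  rewrite map_line; apply: eq_mmap => [x|i] /=.
    by rewrite /horner_eval hornerC.
  by rewrite /horner_eval !hornerE.
have evQj c : (Q`_j).[c] = (line idfun P (fun i => v i + w i * c) G)`_j.
  by rewrite -evQ coef_map.
suff Qj0 : Q`_j = 0.
  rewrite -[RHS](horner0 0) -Qj0 evQj; congr ((polyseq _)`_j).
  by apply: eq_mmap => // i; rewrite mulr0 addr0.
have l_neq0 : (\sum_i a i * v i)%:P + (\sum_i a i * w i)%:P * 'X != 0 :> {poly k}.
  apply: contraNneq aw => /(congr1 (fun p : {poly k} => p`_1)).
  by rewrite coefD coefC coefMX coefC /= add0r coef0 => ->.
suff /eqP : ((\sum_i a i * v i)%:P + (\sum_i a i * w i)%:P * 'X) * Q`_j = 0.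
  by rewrite mulf_eq0 (negPf l_neq0) => /eqP.
apply: poly_eq0_horner => // c.
rewrite hornerM evQj !hornerE.
have ltj1 : (j.+1 < m)%N by lia.
(* As [P] lies on the hyperplane, the linear form along the line is [X] times its value at the
   direction. Coefficient [j.+1] of the product is therefore that value times coefficient [j] of
   [G]: one order is lost. *)
have := vanLG (fun i => v i + w i * c) j.+1 ltj1.
rewrite rmorphM /= line_linear_form aP polyC0 add0r -mulrA coefCM coefXM /=.
under eq_bigr do rewrite mulrDr mulrA.
by rewrite big_split /= -mulr_suml.
Qed.

Lemma pihomog_linearM (n : nat) (k : comNzRingType) (L G : {mpoly k[n]})
    (d : nat) : L \is 1.-homog -> L * G \is d.-homog ->
  exists2 G', G' \is d.-1.-homog & L * G = L * G'.
Proof.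
move=> homL homLG.
(* The component of [G] of degree [d.-1], as a sum with at most one term that is empty when
   [d = 0]. *)
pose G' := \sum_(e < msize G | e.+1 == d) pihomog mdeg e G.
exists G'.
  by apply: rpred_sum => e /eqP <-; exact: pihomogP.
rewrite -[LHS](pihomog_dE homLG).
rewrite {1}(pihomog_partitionE (mf := mdeg) (leqnn (msize G))).
rewrite mulr_sumr raddf_sum mulr_sumr [RHS]big_mkcond /=.
apply: eq_bigr => e _.
have homLe : L * pihomog mdeg e G \is e.+1.-homog.
  by rewrite -add1n; apply: dhomogM => //; exact: pihomogP.
case: eqP => [<-|/eqP ne]; first exact: pihomog_dE.
exact: pihomog_ne0 homLe.
Qed.

(** * Star configurations *)

(* A point of [P^N] is a nonzero polynomial of degree at most [N], up to
   scaling.  The hyperplane [root_form u] consists of those vanishing at [u],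
   and the points of the star configuration are the products of [N] distinct
   linear factors. *)
Definition root_form (n : nat) (k : comNzRingType) (u : k) : {mpoly k[n]} :=
  linear_form (fun i : 'I_n => u ^+ i).

Definition star_point (n : nat) (k : comNzRingType) (T : seq k) (i : 'I_n) : k :=
  (\prod_(t <- T) ('X - t%:P))`_i.

(** The sum is the value at [u] of the polynomial with roots [T], whose degree is below [n], so that
    no coefficient is left out. *)
Lemma root_form_star_point (n : nat) (k : idomainType) (u : k) (T : seq k) :
  (size T < n)%N ->
  (\sum_(i < n) u ^+ i * star_point T i == 0) = (u \in T).
Proof.
move=> ltTn; rewrite -root_prod_XsubC rootE.
rewrite (@horner_coef_wide _ n) ?size_prod_XsubC //.
by congr (_ == 0); apply: eq_bigr => i _; rewrite mulrC.
Qed.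

(* The coefficients of [(X - u) * \sum_j q_j X^j]. *)
Definition mul_root (n : nat) (k A : comNzRingType) (f : k -> A) (u : k)
    (q : 'I_n.+1 -> A) (i : 'I_n.+2) : A :=
  (if i == 0 then 0 else q (inord i.-1)) -
  f u * (if (i <= n)%N then q (inord i) else 0).

Lemma mul_root_star_point (n : nat) (k : comNzRingType) (u : k) (T : seq k) :
  (size T <= n)%N ->
  mul_root (n := n) idfun u (star_point T) =1 star_point (u :: T).
Proof.
move=> leTn i; rewrite /mul_root /star_point big_cons mulrBl coefB coefXM coefCM.
have -> : (i == 0) = (i == 0%N :> nat) by [].
congr (_ - _ * _).
  by case: (i : nat) (ltn_ord i) => [|i'] //= lti; rewrite inordK.
have [lein|ltni] := leqP i n; first by rewrite inordK.
by rewrite nth_default // size_prod_XsubC (leq_ltn_trans leTn).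
Qed.

(** Multiplication by [X - u] parametrizes the hyperplane of polynomials vanishing at [u] by
    polynomials of degree one less; a form is restricted by pulling it back along this map. *)
Definition restrict (n : nat) (k : comNzRingType) (u : k) :
    {mpoly k[n.+2]} -> {mpoly k[n.+1]} :=
  mmap (@mpolyC _ _) (mul_root (@mpolyC _ _) u (fun j : 'I_n.+1 => 'X_j)).

HB.instance Definition _ (n : nat) (k : comNzRingType) (u : k) :=
  GRing.RMorphism.copy (@restrict n k u) (mmap (@mpolyC _ _) _).

Lemma vanishes_restrict (n : nat) (k : comNzRingType) (u : k) (m : nat)
    (T : seq k) (F : {mpoly k[n.+2]}) : (size T <= n)%N ->
  vanishes m (star_point (u :: T)) F -> vanishes m (star_point T) (restrict u F).
Proof.
move=> leTn vanF.
apply: (vanishes_mmap (q' := mul_root idfun u)); last first.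
  move=> v; have := vanF v; congr ord_ge; apply: eq_mmap => // i.
  by rewrite mul_root_star_point.
move=> P v i; rewrite /line /mul_root rmorphB rmorphM /= mmapC.
case: (i == 0); case: (i <= n)%N;
  rewrite ?rmorph0 ?(mmapX _ (polyC \o idfun)) ?mmap1U /= ?mulr0 ?subr0 ?sub0r;
  rewrite ?rmorphB ?rmorphN ?rmorphM /=; ring.
Qed.

Lemma restrict_homog (n : nat) (k : comNzRingType) (u : k) (d : nat)
    (F : {mpoly k[n.+2]}) : F \is d.-homog -> restrict u F \is d.-homog.
Proof.
move=> homF; rewrite /restrict /mmap big_seq; apply: rpred_sum => m suppm.
rewrite mul_mpolyC; apply: rpredZ; rewrite -(dhomog_mf homF suppm) /= mdegE.
rewrite /mmap1; elim/big_rec2: _ => [|i d' p _ homp]; first exact: dhomog1.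
apply: dhomogM => //; rewrite -[X in X.-homog]mul1n; apply: dhomogMn.
have homX j : ('X_j : {mpoly k[n.+1]}) \is 1.-homog by rewrite dhomogX /= mdeg1.
by apply: rpredB; [|rewrite mul_mpolyC; apply: rpredZ]; case: ifP => _;
  rewrite ?rpred0.
Qed.

(** At [t] the product [(X - u) q] takes the value [(t - u) q(t)], so the other hyperplanes restrict
    to hyperplanes of the same kind. *)
Lemma restrict_root_form (n : nat) (k : comNzRingType) (u t : k) :
  restrict u (root_form n.+2 t) = (t - u) *: root_form n.+1 t.
Proof.
rewrite /restrict /root_form mmap_linear_form /mul_root.
under eq_bigr do rewrite mulrBr.
rewrite sumrB big_ord_recl /= mulr0 add0r [X in _ - X]big_ord_recr /=.
rewrite ltnn !mulr0 addr0 scalerBl !scaler_sumr; congr (_ - _).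
  apply: eq_bigr => i _; rewrite /bump /= add1n inord_val exprS mul_mpolyC scalerA //.
apply: eq_bigr => i _; rewrite -ltnS ltn_ord inord_val.
by rewrite mulrCA !mul_mpolyC.
Qed.

Lemma root_form_neq0 (n : nat) (k : comNzRingType) (u : k) :
  root_form n.+1 u != 0.
Proof.
apply/negP => /eqP /(congr1 (mcoeff U_(0))).
rewrite /root_form /linear_form raddf_sum big_ord_recl /= mcoeffZ mcoeffX eqxx.
rewrite mulr1 big1 ?addr0 ?mcoeff0 ?expr0 => [/eqP|i _]; first by rewrite oner_eq0.
by rewrite mcoeffZ mcoeffX eq_mnm1 mulr0.
Qed.

(* The quotient of [\sum_j x_j X^j] by [X - u]. *)
Definition div_root (n : nat) (k : comNzRingType) (u : k) (i : 'I_n.+1) :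
    {mpoly k[n.+2]} :=
  \sum_(j < n.+2 | (i < j)%N) u ^+ (j - i.+1) *: 'X_j.

(** Euclidean division: [X - u] times the quotient is the polynomial minus its value at [u]. That
    value is [root_form u] and changes only the constant coefficient. *)
Lemma mul_div_root (n : nat) (k : comNzRingType) (u : k) (i : 'I_n.+2) :
  mul_root (@mpolyC _ _) u (div_root (n := n) u) i =
  'X_i - (if i == 0 then root_form n.+2 u else 0).
Proof.
have tail (l : nat) : (l <= n.+1)%N ->
    \sum_(j < n.+2 | (l <= j)%N) u ^+ (j - l) *: 'X_j =
    'X_(inord l) + u *: (\sum_(j < n.+2 | (l < j)%N) u ^+ (j - l.+1) *: 'X_j)
    :> {mpoly k[n.+2]}.
  move=> leln; rewrite (bigD1 (inord l)) /=; last by rewrite inordK.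
  rewrite inordK // subnn expr0 scale1r scaler_sumr; congr (_ + _).
  apply: eq_big => [j|j /andP[lej nej]].
    by rewrite ltn_neqAle andbC -val_eqE /= inordK // eq_sym.
  rewrite scalerA -exprS; congr (_ ^+ _ *: _).
  by move: nej; rewrite -val_eqE /= inordK // => nej; lia.
have tailn (l : nat) : (n.+1 <= l)%N ->
    \sum_(j < n.+2 | (l < j)%N) u ^+ (j - l.+1) *: 'X_j = 0 :> {mpoly k[n.+2]}.
  by move=> le; rewrite big_pred0 // => j; have := ltn_ord j; lia.
have divE : mpolyC n.+2 u * (if (i <= n)%N then div_root u (inord i) else 0) =
    u *: (\sum_(j < n.+2 | (i < j)%N) u ^+ (j - i.+1) *: 'X_j).
  rewrite mul_mpolyC; have [lein|ltni] := leqP i n; last by rewrite tailn.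
  by rewrite /div_root inordK.
rewrite /mul_root divE; have lti := ltn_ord i.
have -> : (i == 0) = (i == 0%N :> nat) by [].
case: eqVneq => [i0|i_neq0].
  have -> : root_form n.+2 u =
      \sum_(j < n.+2 | (0 <= j)%N) u ^+ (j - 0) *: 'X_j.
    by apply: eq_bigr => j _; rewrite subn0.
  have -> : i = inord 0 by apply: ord_inj; rewrite inordK.
  by rewrite (tail 0%N) // inordK // opprD addrA subrr.
have -> : div_root u (inord i.-1) =
    \sum_(j < n.+2 | (i <= j)%N) u ^+ (j - i) *: 'X_j :> {mpoly k[n.+2]}.
  by rewrite /div_root inordK ?prednK ?lt0n //; lia.
by rewrite (tail i) // inord_val subr0 addrK.
Qed.

Lemma mmap_sub_eq (n : nat) (k : nzRingType) (S : comNzRingType)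
    (f : {rmorphism k -> S}) (h h' : 'I_n -> S) (L : S) (p : {mpoly k[n]}) :
  (forall i, exists c, h i = h' i + L * c) ->
  exists c, mmap f h p = mmap f h' p + L * c.
Proof.
move=> eqh; elim/mpolyind: p => [|a m p _ _ [c IH]].
  by exists 0; rewrite !mmap0 mulr0 addr0.
suff [c' eqm] : exists c', mmap1 h m = mmap1 h' m + L * c'.
  exists (f a * c' + c); rewrite !mmapD !mmapZ !mmapX eqm IH mulrDr.
  by rewrite addrACA mulrDr [L * (f a * _)]mulrCA.
rewrite /mmap1; elim/big_rec2: _ => [|i x y _ [c1 ->]].
  by exists 0; rewrite mulr0 addr0.
have [c2 ->] : exists c2, h i ^+ m i = h' i ^+ m i + L * c2.
  have [c2 ->] := eqh i; elim: (m i) => [|e [c3 IHe]].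
    by exists 0; rewrite mulr0 addr0.
  exists (c2 * h' i ^+ e + h' i * c3 + L * c2 * c3).
  by rewrite !exprS IHe; ring.
by exists (c2 * x + h' i ^+ m i * c1 + L * c2 * c1); ring.
Qed.

(** By [mul_div_root], modulo [root_form u] each variable is congruent to a coefficient of [X - u]
    times the quotient. Hence [F] is congruent to its restriction evaluated at the quotient, which
    is zero. *)
Lemma restrict_eq0 (n : nat) (k : idomainType) (u : k) (d : nat)
    (F : {mpoly k[n.+2]}) : F \is d.-homog -> restrict u F = 0 ->
  exists2 G, G \is d.-1.-homog & F = root_form n.+2 u * G.
Proof.
move=> homF resF.
have [|G FE] := @mmap_sub_eq _ _ _ (@mpolyC n.+2 k) (fun i => 'X_i)
    (mul_root (@mpolyC _ _) u (div_root (n := n) u)) (root_form n.+2 u) F.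
  move=> i; rewrite mul_div_root.
  exists (if i == 0 then 1 else 0).
  by case: (i == 0); rewrite ?mulr1 ?mulr0 ?subrK // subr0 addr0.
have FX : mmap (@mpolyC _ _) (fun i => 'X_i) F = F.
  rewrite [RHS]mpolyE; apply: eq_bigr => m _.
  by rewrite mul_mpolyC mmap1_id.
have F0 : mmap (@mpolyC _ _) (mul_root (@mpolyC _ _) u (div_root (n := n) u)) F = 0.
  have := congr1 (mmap (@mpolyC _ _) (div_root u)) resF.
  rewrite raddf0 /restrict mmap_comp => res0; rewrite -[RHS]res0.
  apply: eq_mmap => // i; rewrite /mul_root rmorphB rmorphM /= mmapC.
  congr (_ - _ * _).
    by case: (i == 0); rewrite ?raddf0 // mmapX mmap1U.
  by case: (i <= n)%N; rewrite ?raddf0 // mmapX mmap1U.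
rewrite FX F0 add0r in FE; rewrite FE in homF *.
exact: pihomog_linearM (linear_form_homog _) homF.
Qed.

(** Factors are split off one at a time: for [t != u] the restriction of [root_form t] is nonzero,
    so the restriction of the cofactor must vanish. *)
Lemma restrict_eq0_all (n : nat) (k : idomainType) (U : seq k) (d : nat)
    (F : {mpoly k[n.+2]}) :
  uniq U -> F \is d.-homog -> {in U, forall u, restrict u F = 0} ->
  exists2 G, G \is (d - size U).-homog & F = (\prod_(u <- U) root_form n.+2 u) * G.
Proof.
move=> uniqU homF; elim: U uniqU => [_ _|u U IH /= /andP[uU uniqU] resF].
  by exists F; rewrite ?subn0 // big_nil mul1r.
have [//|t tU|G homG FE] := IH _; first by apply: resF; rewrite inE tU orbT.
have resG : restrict u G = 0.
  have /eqP := resF u (mem_head _ _).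
  rewrite {}FE rmorphM rmorph_prod mulf_eq0 prodf_seq_eq0.
  case/orP=> [/hasP[t tU /eqP]|/eqP //].
  rewrite /= restrict_root_form => /eqP.
  rewrite -mul_mpolyC mulf_eq0 mpolyC_eq0 (negPf (root_form_neq0 _ _)) orbF subr_eq0.
  by move/eqP => eq_tu; rewrite -eq_tu tU in uU.
have [G' homG' GE] := restrict_eq0 homG resG.
by exists G'; rewrite ?subnS // big_cons FE GE mulrCA mulrA.
Qed.

Lemma prod_root_form_homog (n : nat) (k : comNzRingType) (U : seq k) :
  \prod_(u <- U) root_form n u \is (size U).-homog.
Proof.
elim: U => [|u U IH]; first by rewrite big_nil dhomog1.
by rewrite big_cons /= -add1n; apply: dhomogM => //; exact: linear_form_homog.
Qed.

Lemma vanishes_div_prod (n : nat) (k : fieldType) (U T : seq k) (m : nat)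
    (G : {mpoly k[n.+1]}) :
  [pchar k] =i pred0 -> (size T <= n)%N ->
  vanishes m (star_point T) ((\prod_(u <- U) root_form n.+1 u) * G) ->
  vanishes (m - count (mem T) U) (star_point T) G.
Proof.
move=> char0 leTn; elim: U m => [|u U IH] m /=.
  by rewrite big_nil mul1r subn0.
rewrite big_cons -mulrA; have := @root_form_star_point n.+1 k u T leTn.
case: (u \in T) => [/eqP uP|/negbT uP].
  rewrite add1n subnS -subn1 subnAC subn1 => van; apply: IH.
  (* The first basis vector is transverse, since [root_form u] takes the value [u ^+ 0 = 1]
     there. *)
  apply: (@vanishes_divl_eq0 _ _ _ _ _ (fun i => (i == 0)%:R) _ char0 uP _ van).
  rewrite big_ord_recl mulr1 big1 ?addr0 ?oner_neq0 // => i _.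
  by rewrite mulr0.
by rewrite add0n => /(vanishes_divl_neq0 uP); exact: IH.
Qed.

(** In one variable a form is a single monomial, and its value at 1 is its coefficient. *)
Lemma homog1_neq0 (k : comNzRingType) (d : nat) (F : {mpoly k[1]}) :
  F \is d.-homog -> F != 0 -> mmap idfun (fun=> 1) F != 0.
Proof.
move=> homF F_neq0.
have FE : F = F@_(mlead F) *: 'X_[mlead F].
  apply/mpolyP => m; rewrite mcoeffZ mcoeffX.
  case: eqP => [<-|ne]; rewrite ?mulr1 // mulr0.
  apply: (dhomog_nemf_coeff homF); apply: contra_notN ne => /eqP md.
  have := dhomog_mf homF (mlead_supp F_neq0); rewrite -md /= !mdegE !big_ord1.
  by move=> eq0; apply/mnmP => i; rewrite ord1.
rewrite FE mmapZ mmapX /= /mmap1 big1 ?mulr1 ?mleadc_eq0 // => i _.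
by rewrite expr1n.
Qed.

(* If [d N < m s] then [F] restricts to zero on each of the [s] hyperplanes, by
   induction on [N]; dividing [F] by their product lowers [d] by [s] and [m] by
   [N], which preserves the inequality. *)
Lemma star_bound (n : nat) (k : fieldType) (U : seq k) (d m : nat)
    (F : {mpoly k[n.+1]}) :
  [pchar k] =i pred0 -> uniq U -> (n <= size U)%N -> F != 0 -> F \is d.-homog ->
  (forall T, uniq T -> {subset T <= U} -> size T = n ->
     vanishes m (star_point T) F) ->
  (m * size U <= d * n)%N /\ (n = 0%N -> m = 0%N).
Proof.
move=> char0; elim: n U d m F => [|n IHn] U d m F uniqU leU F_neq0 homF vanF.
  (* In dimension 0 the only star point is the constant polynomial 1, where a nonzero form does not
     vanish. The inequality alone would not give [m = 0] when [U] is empty. *)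
  suff -> : m = 0%N by [].
  apply/eqP; rewrite -leqn0 leqNgt; apply/negP => m_gt0.
  have sub0 : {subset [::] <= U} by [].
  have /(_ (fun=> 0) 0%N m_gt0) := vanF [::] isT sub0 erefl.
  apply/eqP; rewrite line_coef0; have := homog1_neq0 homF F_neq0.
  congr (_ != 0); apply: eq_mmap => // i.
  by rewrite /star_point big_nil ord1 coef1.
split=> //; elim/ltn_ind: d m F F_neq0 homF vanF => d IHd m F F_neq0 homF vanF.
rewrite leqNgt; apply/negP => lt_dm.
have resF : {in U, forall u, restrict u F = 0}.
  move=> u uU; apply/eqP/negPn/negP => res_neq0.
  have [|T uT subT sT|le_md m0] :=
      IHn (rem u U) d m _ (rem_uniq u uniqU) _ res_neq0 (restrict_homog u homF).
  - by rewrite size_rem // -ltnS prednK // (leq_trans _ leU).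
  - apply: vanishes_restrict; first by rewrite sT.
    apply: vanF; last by rewrite /= sT.
      rewrite /= uT andbT; apply/negP => /subT.
      by rewrite mem_rem_uniq // !inE eqxx.
    by move=> t; rewrite inE => /predU1P[->//|/subT/mem_rem].
  rewrite size_rem // in le_md.
  have [n0|n_gt0] := posnP n; first by move: lt_dm; rewrite m0.
  (* With [s = size U], this says that [n / (s - 1)] is at most [(n + 1) / s]: the bound on the
     hyperplane implies the one wanted here. *)
  have le_sn : (size U * n <= (size U).-1 * n.+1)%N by case: (size U) leU; lia.
  have := leq_mul (leqnn m) le_sn; have := leq_mul le_md (leqnn n.+1).
  have := lt_dm; rewrite -(ltn_pmul2r n_gt0) !mulnA => lt1 le1 le2.
  move: (leq_trans le2 le1); rewrite leqNgt => /negP; apply.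
  by rewrite mulnAC.
have [G homG FE] := restrict_eq0_all uniqU homF resF.
have G_neq0 : G != 0 by apply: contraNneq F_neq0 => G0; rewrite FE G0 mulr0.
(* The degree of [G] is a truncated difference; comparing degrees in the factorization shows that
   nothing is truncated. *)
have le_sd : (size U <= d)%N.
  have homF' := dhomogM (prod_root_form_homog n.+2 U) homG.
  by rewrite -FE in homF'; rewrite (dhomog_uniq F_neq0 homF homF') leq_addr.
have lt_dd : (d - size U < d)%N by lia.
have := IHd _ lt_dd (m - n.+1)%N G G_neq0 homG; rewrite leqNgt => h.
have {h}/h : forall T : seq k, uniq T -> {subset T <= U} -> size T = n.+1 ->
    vanishes (m - n.+1) (star_point T) G.
  move=> T uT subT sT; have := vanF T uT subT sT; rewrite FE.
  move/vanishes_div_prod => /(_ char0); rewrite sT => /(_ (leqnn _)).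
  have -> // : count (mem T) U = n.+1.
  rewrite -sT -size_filter; apply/perm_size/uniq_perm => //.
    exact: filter_uniq.
  by move=> t; rewrite mem_filter /=; case: (boolP (t \in T)) => // /subT.
(* Subtract [size U * n.+1] from both sides of [lt_dm]; by [le_sd] both differences are exact. *)
apply/negP; rewrite negbK; nia.
Qed.

(** * Ideals of points and their symbolic powers *)

(** The polynomial [f(t P)] in [t], a morphism to a domain whose kernel turns out to be the ideal of
    [P]. *)
Definition cone_eval (K : fieldType) (N : nat) (P : 'I_N.+1 -> K) :
  {mpoly K[N.+1]} -> {poly K} := mmap polyC (fun i => (P i) *: 'X).

HB.instance Definition _ (K : fieldType) (N : nat) (P : 'I_N.+1 -> K) :=
  GRing.RMorphism.copy (cone_eval P) (mmap polyC _).

Lemma cone_eval_homog (K : fieldType) (N : nat) (P : 'I_N.+1 -> K) (d : nat)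
    (f : {mpoly K[N.+1]}) : f \is d.-homog -> cone_eval P f = f.@[P] *: 'X^d.
Proof.
move=> homf; rewrite /cone_eval /mmap mevalE scaler_suml !big_seq.
apply: eq_bigr => m suppm; rewrite mul_polyC -scalerA; congr (_ *: _).
rewrite -(dhomog_mf homf suppm) /= mdegE /mmap1.
elim/big_rec3: _ => [|i x p q _ ->]; first by rewrite scale1r.
by rewrite exprZn -scalerAl -scalerAr scalerA exprD.
Qed.

(** The coefficient of [t^d] in [f(t P)] is the value at [P] of the component of [f] of degree
    [d]. *)
Lemma point_idealP (K : fieldType) (N : nat) (P : 'I_N.+1 -> K)
    (f : {mpoly K[N.+1]}) : point_ideal P f <-> cone_eval P f = 0.
Proof.
split=> [[r [c [a [Ia ->]]]]|f0].
  rewrite raddf_sum big1 // => t _; have [[d homa] a0] := Ia t.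
  rewrite /= rmorphM /=.
  by rewrite (cone_eval_homog P homa) a0 scale0r mulr0.
exists (msize f), (fun=> 1), (fun d => pihomog mdeg d f); split; last first.
  under eq_bigr do rewrite mul1r.
  exact: pihomog_partitionE.
move=> d; split; first by exists d; exact: pihomogP.
have := congr1 (fun p : {poly K} => p`_d) f0.
rewrite [X in cone_eval _ X](pihomog_partitionE (mf := mdeg) (leqnn (msize f)));
rewrite coef0.
rewrite raddf_sum coef_sum (bigD1 d) //=.
rewrite (cone_eval_homog P (pihomogP _ _ _)) coefZ coefXn eqxx mulr1.
rewrite big1 ?addr0 // => e ne.
rewrite (cone_eval_homog P (pihomogP _ _ _)) coefZ coefXn.
by rewrite eq_sym (inj_eq val_inj) (negPf ne) mulr0.
Qed.

Lemma point_ideal_homog (K : fieldType) (N : nat) (P : 'I_N.+1 -> K) (d : nat)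
    (f : {mpoly K[N.+1]}) : f \is d.-homog -> f.@[P] = 0 -> point_ideal P f.
Proof.
by move=> homf f0; apply/point_idealP; rewrite (cone_eval_homog P homf) f0 scale0r.
Qed.

Lemma point_ideal_mull (K : fieldType) (N : nat) (P : 'I_N.+1 -> K)
    (f g : {mpoly K[N.+1]}) : point_ideal P g -> point_ideal P (f * g).
Proof. by rewrite !point_idealP rmorphM /= => ->; rewrite mulr0. Qed.

Lemma point_ideal_prime (K : fieldType) (N : nat) (P : 'I_N.+1 -> K) :
  prime_ideal (point_ideal P).
Proof.
split; last first.
  move=> f g; rewrite !in_setE; rewrite point_idealP rmorphM /= => /eqP.
  rewrite mulf_eq0 => /orP[/eqP f0|/eqP g0]; apply/orP; [left|right];
    by rewrite in_setE; apply/point_idealP.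
split.
- by rewrite in_setE; apply/point_idealP; rewrite rmorph0.
- apply/negP; rewrite in_setE => /point_idealP.
  by rewrite rmorph1 => /eqP; rewrite oner_eq0.
- move=> a f g; rewrite !in_setE !point_idealP => f0 g0.
  by rewrite rmorphD rmorphM /= f0 g0 mulr0 addr0.
Qed.

(* For a point [P] this sends [f] to [f(t P + X v)], whose constant term in [X]
   is zero exactly when [f] is in the ideal of [P]. *)
Definition cone_line (K : fieldType) (N : nat) (P v : 'I_N.+1 -> K) :
    {mpoly K[N.+1]} -> {poly {poly K}} :=
  line (@polyC K) (fun i => P i *: 'X) (fun i => (v i)%:P).

HB.instance Definition _ (K : fieldType) (N : nat) (P v : 'I_N.+1 -> K) :=
  GRing.RMorphism.copy (cone_line P v) (line polyC _ _).

Lemma ideal_exp_cone_line (K : fieldType) (N : nat) (P v : 'I_N.+1 -> K)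
    (J : set {mpoly K[N.+1]}) (m : nat) (f : {mpoly K[N.+1]}) :
  (J `<=` point_ideal P)%classic -> ideal_exp J m f -> ord_ge m (cone_line P v f).
Proof.
move=> JP [r [c [a [Ja ->]]]]; rewrite raddf_sum.
elim/big_ind: _ => [j _|p q|t _]; [by rewrite coef0|exact: ord_geD|].
have [b [Jb ->]] := Ja t.
rewrite /= rmorphM; apply: ord_ge_mulr; rewrite rmorph_prod.
elim: m b {Ja a c r t} Jb => [|m IH] b Jb //.
rewrite big_ord_recl; apply: (@ord_geM _ 1); last by apply: IH => t.
by case=> // _; rewrite line_coef0; apply/point_idealP/JP.
Qed.

(** Clearing denominators gives [s * F = b] with [b] of order [m]. The denominator [s] may be
    inhomogeneous and vanish at [P] itself, but not on the whole cone over [P]; so it is cancelled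
    along [t P + X v], and only then is [t] set to 1. *)
Lemma localized_ideal_line (K : fieldType) (N : nat) (P v : 'I_N.+1 -> K)
    (J : set {mpoly K[N.+1]}) (m : nat) (F : {mpoly K[N.+1]}) :
  (J `<=` point_ideal P)%classic ->
  localized_ideal (point_ideal P) (ideal_exp J m) (tofrac F) ->
  ord_ge m (line idfun P v F).
Proof.
move=> JP [r [c [a [locc Ia FE]]]].
have [b [s [s0 ordb Fbs]]] : exists b s, [/\ cone_eval P s != 0,
    ord_ge m (cone_line P v b) & tofrac F = tofrac b / tofrac s].
  have neq0 s : cone_eval P s != 0 -> tofrac s != 0.
    by rewrite tofrac_eq0; apply: contraNneq => ->; rewrite rmorph0.
  rewrite FE; elim/big_ind: _ => [|x y [b1 [s1 [s10 ord1 ->]]] [b2 [s2 [s20 ord2 ->]]]|t _].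
  - exists 0, 1; split; first by rewrite rmorph1 oner_neq0.
      by move=> j _; rewrite rmorph0 coef0.
    by rewrite rmorph0 mul0r.
  - exists (b1 * s2 + b2 * s1), (s1 * s2); split.
    + by rewrite rmorphM mulf_neq0.
    + by rewrite rmorphD !rmorphM; apply: ord_geD; rewrite mulrC; apply: ord_ge_mulr.
    + by rewrite addf_div ?neq0 // rmorphD !rmorphM.
  - have [u [s [sP ->]]] := locc t.
    exists (u * a t), s; split.
    + by apply/eqP => /point_idealP.
    + by rewrite rmorphM; apply: ord_ge_mulr; apply: ideal_exp_cone_line (Ia t).
    + by rewrite rmorphM mulrAC.
have sF : s * F = b.
  have s_neq0 : tofrac s != 0.
    by rewrite tofrac_eq0; apply: contraNneq s0 => ->; rewrite rmorph0.
  apply/eqP; rewrite -(tofrac_eq (s * F)) rmorphM /= Fbs.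
  by rewrite mulrCA divff ?mulr1.
have ordF : ord_ge m (cone_line P v F).
  move: ordb; rewrite -sF rmorphM; apply: ord_ge_cancel.
  by rewrite line_coef0.
have -> : line idfun P v F = map_poly (horner_eval 1) (cone_line P v F).
  rewrite map_line; apply: eq_mmap => [x|i] /=.
    by rewrite /horner_eval hornerC.
  by rewrite /horner_eval hornerZ hornerX hornerC mulr1.
by move=> j ltj; rewrite coef_map /= ordF // /horner_eval horner0.
Qed.

(** The witness is a product over [j != i] of linear forms vanishing at [P j] but not at [P i]; its
    annihilator modulo the intersection is the ideal of [P i]. *)
Lemma associated_prime_points (K : fieldType) (N n : nat)
    (P : 'I_n -> 'I_N.+1 -> K) (i : 'I_n) (l0 l1 : 'I_N.+1) :
  (forall j, j != i -> P j l1 * P i l0 - P j l0 * P i l1 != 0) ->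
  associated_prime (\bigcap_(j in [set: 'I_n]) point_ideal (P j))%classic
    (point_ideal (P i)).
Proof.
move=> neqP; split; first exact: point_ideal_prime.
pose f j : {mpoly K[N.+1]} := P j l1 *: 'X_l0 - P j l0 *: 'X_l1.
have homf j : f j \is 1.-homog.
  by apply: rpredB; apply: rpredZ; rewrite dhomogX /= mdeg1.
have evf j h : (f j).@[P h] = P j l1 * P h l0 - P j l0 * P h l1.
  by rewrite mevalB !mevalZ !mevalXU.
exists (\prod_(j | j != i) f j); apply/seteqP; split=> g /=.
  move=> Pg j _; have [->|ne_ji] := eqVneq j i.
    by rewrite mulrC; apply: point_ideal_mull.
  rewrite (bigD1 j) //= mulrCA mulrC; apply: point_ideal_mull.
  apply: point_ideal_homog (homf j) _.
  by rewrite evf mulrC subrr.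
move=> /(_ i I) /point_idealP; rewrite rmorphM rmorph_prod /= => /eqP.
rewrite mulf_eq0 => /orP[/eqP /point_idealP //|].
rewrite prodf_seq_eq0 => /hasP[j _ /andP[ne_ji]].
rewrite (cone_eval_homog _ (homf j)) evf.
by rewrite scaler_eq0 (negPf (neqP _ ne_ji)) -size_poly_eq0 size_polyXn.
Qed.

Lemma generic_points_distinct (k : fieldType) (N n : nat) (i j : 'I_n)
    (l0 l1 : 'I_N.+1) : j != i -> l0 != l1 ->
  generic_point k j l1 * generic_point k i l0 -
  generic_point k j l0 * generic_point k i l1 != 0.
Proof.
move=> ne_ji ne_l; rewrite /generic_point -!rmorphM -rmorphB tofrac_eq0.
(* Setting the variables at [(j, l1)] and [(i, l0)] to 1 and all others to 0 makes the minor equal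
   to 1. *)
pose M : 'M[k]_(n, N.+1) :=
  \matrix_(x, y) (((x == j) && (y == l1)) || ((x == i) && (y == l0)))%:R.
apply/negP => /eqP /(congr1 (meval (fun x => mxvec M 0 x))) /eqP.
rewrite mevalB !mevalM !mevalXU !mxvecE !mxE meval0 !eqxx orbT /=.
by rewrite (negPf ne_ji) (negPf ne_l) /= mulr1 mul0r subr0 oner_eq0.
Qed.

Lemma symbolic_power_vanishing (k : fieldType) (N n m : nat)
    (F : {mpoly {fraction {mpoly k[n * N.+1]}}[N.+1]}) (i : 'I_n) v :
  (1 <= N)%N -> symbolic_power (generic_points_ideal k n N) m F ->
  ord_ge m (line idfun (@generic_point k n N i) v F).
Proof.
move=> N_ge1 symF; apply: localized_ideal_line (symF _ _); last first.
  apply: (@associated_prime_points _ _ _ _ i ord0 ord_max) => j ne_ji.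
  apply: generic_points_distinct => //.
  by rewrite -val_eqE /= eq_sym -lt0n.
by move=> f; apply.
Qed.

Lemma ideal_exp_symbolic_power (R : idomainType) (J : set R) (m : nat) (f : R) :
  ideal_exp J m f -> symbolic_power J m f.
Proof.
move=> Jf p [[[_ p1 _] _] _]; exists 1%N, (fun=> 1), (fun=> f); split=> //.
  move=> _; exists 1, 1; split; last by rewrite divr1.
  by move=> p1'; move/negP: p1; apply; rewrite in_setE.
by rewrite big_ord1 mul1r.
Qed.

(** * Forms through generic points *)

(** The witness [f] rules out the default value of [alpha], so the minimum is attained. *)
Lemma alphaP (K : fieldType) (n d : nat) (J : set {mpoly K[n]}) (f : {mpoly K[n]}) :
  J f -> f != 0 -> f \is d.-homog ->
  (alpha J <= d)%N /\
  exists g, [/\ J g, g != 0 & g \is (alpha J).-homog].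
Proof.
move=> Jf f0 homf.
pose deg e := exists f, [/\ J f, f != 0 & f \is e.-homog].
have exdeg : exists e, `[< deg e >] by exists d; apply/asboolP; exists f.
have := @xgetPex _ 0%N [set d | deg d /\ forall e, deg e -> (d <= e)%N]%classic.
case.
  case: (ex_minnP exdeg) => e /asboolP dege mine.
  by exists e; split=> // e' dege'; apply: mine; apply/asboolP.
move=> degalpha minalpha; split=> //.
by apply: minalpha; exists f.
Qed.

Definition form_eval (K : fieldType) (N n d : nat) (P : 'I_n -> 'I_N.+1 -> K)
  (f : dhomog N.+1 K d) : 'rV[K]_n := \row_i (val f).@[P i].

Lemma form_eval_is_linear (K : fieldType) (N n d : nat)
  (P : 'I_n -> 'I_N.+1 -> K) : linear (form_eval (d := d) P).
Proof.
move=> a f g; apply/rowP => i; rewrite !mxE /=.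
by rewrite mevalD mevalZ.
Qed.

HB.instance Definition _ (K : fieldType) (N n d : nat)
    (P : 'I_n -> 'I_N.+1 -> K) :=
  GRing.isLinear.Build K (dhomog N.+1 K d) 'rV[K]_n _ (form_eval P)
    (form_eval_is_linear P).

(** The forms of degree [d] have dimension ['C(d + N, d)], which exceeds the number [n] of linear
    conditions. *)
Lemma exists_form_through (K : fieldType) (N n d : nat)
    (P : 'I_n -> 'I_N.+1 -> K) : (n < 'C(d + N, d))%N ->
  exists f : {mpoly K[N.+1]},
    [/\ f != 0, f \is d.-homog & forall i, f.@[P i] = 0].
Proof.
move=> lt_n; pose E : 'Hom(dhomog N.+1 K d, 'rV[K]_n) := linfun (form_eval P).
have ker_neq0 : lker E != 0%VS.
  apply/eqP => ker0; have := limg_ker_dim E fullv.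
  rewrite ker0 capv0 dimv0 add0n dimvf => dimE.
  have := dimvS (subvf (limg E)); rewrite dimE dimvf /dim /= mul1n.
  by rewrite leqNgt lt_n.
have := vpick0 (lker E); rewrite (negPf ker_neq0) => /negbT pick_neq0.
have := memv_pick (lker E); rewrite memv_ker lfunE /= => /eqP Ef.
exists (val (vpick (lker E))); split.
- by apply: contraNneq pick_neq0 => f0; apply/eqP/val_inj.
- exact: dhomog_is_dhomog.
- by move=> i; have /rowP/(_ i) := Ef; rewrite !mxE.
Qed.

(** * Specialization of the generic points to a star configuration *)

Lemma homog_sum (K : nzRingType) (n d : nat) (F : {mpoly K[n]}) :
  F \is d.-homog ->
  F = \sum_(m in [set m : 'X_{1..n < d.+1} | mdeg m == d]) F@_m *: 'X_[m].
Proof.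
move=> homF; rewrite -[LHS](pihomog_dE homF) (@pihomogwE _ _ _ _ d.+1).
  by apply: eq_bigl => m; rewrite inE.
rewrite msizeE big_seq; elim/big_ind: _ => // [x y lex ley|m suppm].
  by rewrite geq_max lex.
by have /= -> := dhomog_mf homF suppm.
Qed.

Lemma coef_line_sum (K : comNzRingType) (n j D : nat) (P v : 'I_n -> K)
    (c : 'I_D -> K) (x : 'I_D -> 'X_{1..n}) :
  (line idfun P v (\sum_a c a *: 'X_[x a]))`_j =
  \sum_a (mmap1 (fun l => (P l)%:P + (v l)%:P * 'X) (x a))`_j * c a.
Proof.
rewrite raddf_sum coef_sum; apply: eq_bigr => a _ /=.
by rewrite /line (mmapZ _ (polyC \o idfun)) (mmapX _ (polyC \o idfun)) /= coefCM mulrC.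
Qed.

(** The coefficients of [F] solve a linear system with one equation per point, direction and order.
    Directions are taken over [k], so the entries are polynomials in the [z_ij], and
    [kernel_specialize] applies to the substitution of [sigma]. *)
Lemma specialize_forms (k : fieldType) (N n d m : nat)
    (sigma : 'I_n -> 'I_N.+1 -> k)
    (F : {mpoly {fraction {mpoly k[n * N.+1]}}[N.+1]}) :
  F != 0 -> F \is d.-homog ->
  (forall i (v : 'I_N.+1 -> k), ord_ge m
    (line idfun (@generic_point k n N i) (fun l => tofrac (v l)%:MP) F)) ->
  exists F0 : {mpoly k[N.+1]},
    [/\ F0 != 0, F0 \is d.-homog & forall i, vanishes m (sigma i) F0].
Proof.
move=> F_neq0 homF vanF.
set A := [set x : 'X_{1..N.+1 < d.+1} | mdeg x == d].
pose mon (a : 'I_#|A|) : 'X_{1..N.+1} := enum_val a.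
have monK (K : fieldType) (c : 'I_#|A| -> K) a :
    (\sum_b c b *: 'X_[mon b])@_(mon a) = c a.
  rewrite raddf_sum (bigD1 a) //= mcoeffZ mcoeffX eqxx mulr1 big1 ?addr0 // => b.
  rewrite mcoeffZ mcoeffX => ne_ba; case: eqP => [/val_inj/enum_val_inj|_].
    by move/eqP; rewrite (negPf ne_ba).
  by rewrite mulr0.
have FE : F = \sum_a F@_(mon a) *: 'X_[mon a].
  by rewrite {1}(homog_sum homF) big_enum_val.
pose R := {mpoly k[n * N.+1]}.
pose spec := meval (fun x => mxvec (\matrix_(i, l) sigma i l) 0 x) : R -> k.
pose E (i : 'I_n) (v : 'I_N.+1 -> k) x : {poly R} :=
  mmap1 (fun l => ('X_(mxvec_index i l))%:P + ((v l)%:MP)%:P * 'X) x.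
pose r (t : 'I_n * ('I_N.+1 -> k) * 'I_m) : 'rV[R]_#|A| :=
  \row_a (E t.1.1 t.1.2 (mon a))`_t.2.
pose c := \col_a F@_(mon a).
have c_neq0 : c != 0.
  apply: contraNneq F_neq0 => c0; rewrite FE big1 // => a _.
  by have /colP/(_ a) := c0; rewrite !mxE => ->; rewrite scale0r.
have rc0 t : map_mx (@tofrac R) (r t) *m c = 0.
  apply/matrixP => ? ?; rewrite !ord1 !mxE.
  rewrite -[RHS](vanF t.1.1 t.1.2 t.2 (ltn_ord _)) FE coef_line_sum.
  apply: eq_bigr => a _; rewrite !mxE -coef_map (rmorph_mmap1 (map_poly _)).
  congr ((polyseq _)`_ _ * _); apply: mmap1_eq => l /=.
  by rewrite rmorphD rmorphM /= !map_polyC map_polyX.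
have [c0 c0_neq0 rc00] := kernel_specialize spec c_neq0 rc0.
exists (\sum_a c0 a 0 *: 'X_[mon a]); split.
- apply: contraNneq c0_neq0 => F00; apply/eqP/colP => a.
  by rewrite mxE -(monK _ (fun a => c0 a 0)) F00 mcoeff0.
- apply: rpred_sum => a _; apply: rpredZ; rewrite dhomogX.
  by have := enum_valP a; rewrite inE.
move=> i v j ltj; rewrite coef_line_sum.
have /matrixP/(_ 0 0) := rc00 (i, v, Ordinal ltj); rewrite !mxE => rc00E.
rewrite -[RHS]rc00E; apply: eq_bigr => a _.
rewrite !mxE -coef_map (rmorph_mmap1 (map_poly _)).
congr ((polyseq _)`_ _ * _); apply: mmap1_eq => l /=.
by rewrite rmorphD rmorphM /= !map_polyC map_polyX /= mevalXU mxvecE mxE mevalC.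
Qed.

Lemma star_bound_generic (k : fieldType) (N n b m d : nat)
    (F : {mpoly {fraction {mpoly k[n * N.+1]}}[N.+1]}) :
  [pchar k] =i pred0 -> (1 <= N)%N -> ('C(b + N, N) <= n)%N ->
  F != 0 -> F \is d.-homog ->
  symbolic_power (generic_points_ideal k n N) m F -> (m * (b + N) <= d * N)%N.
Proof.
move=> char0 N_ge1 le_n F_neq0 homF symF.
pose A := [set T : {set 'I_(b + N)} | #|T| == N].
have cardA : #|A| = 'C(b + N, N) by rewrite card_draws card_ord.
(* The hyperplanes are indexed by the integers below [b + N], which are distinct in characteristic
   0. *)
pose tau (T : {set 'I_(b + N)}) : seq k := [seq (val i)%:R : k | i <- enum T].
(* Indices past the last subset get the default empty set; their points merely add conditions on the
   specialized form. *)
pose sigma (i : 'I_n) : 'I_N.+1 -> k := star_point (tau (nth finset.set0 (enum A) i)).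
have [i v|F0 [F0_neq0 homF0 vanF0]] :=
    @specialize_forms k N n d m sigma F F_neq0 homF.
  exact: symbolic_power_vanishing.
have natr_inj : injective (fun i : 'I_(b + N) => (val i)%:R : k).
  move=> i j /(natr_inj_pchar0 char0); exact: ord_inj.
pose U := tau (finset.setTfor 'I_(b + N)).
have uniqtau T : uniq (tau T) by rewrite map_inj_uniq ?enum_uniq.
have sizeU : size U = (b + N)%N by rewrite size_map -cardE cardsT card_ord.
have [||//] := @star_bound N k U d m F0 char0 (uniqtau _) _ F0_neq0 homF0.
- by rewrite sizeU leq_addl.
- move=> T uT subT sT.
  (* [T] is a permutation of [tau S], and [le_n] ensures that some generic point is sent to its star
     point. *)
  pose S := [set i : 'I_(b + N) | (val i)%:R \in T].
  have eqT : tau S =i T.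
    move=> t; apply/mapP/idP => [[i]|tT].
      by rewrite mem_enum inE => iT ->.
    have /mapP[i _ ti] := subT t tT.
    by exists i; rewrite // mem_enum inE -ti.
  have SA : S \in enum A.
    rewrite mem_enum inE cardE -(size_map (fun i : 'I__ => (val i)%:R : k)).
    by apply/eqP; apply: etrans sT; apply/perm_size/uniq_perm => //; exact: uniqtau.
  have ltS : (index S (enum A) < n)%N.
    by rewrite (leq_trans _ le_n) // -cardA cardE index_mem.
  move=> v; have := vanF0 (Ordinal ltS) v; congr ord_ge; apply: eq_mmap => // l.
  rewrite /sigma /= nth_index // /star_point.
  by rewrite (perm_big T) //; apply: uniq_perm => //; exact: uniqtau.
by rewrite sizeU.
Qed.

(** Take the largest [b] satisfying the first inequality; it exists because ['C(b + N, N)] exceeds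
    [b]. *)
Lemma exists_bin_sandwich (N n : nat) : (1 <= N)%N -> (1 <= n)%N ->
  exists b, ('C(b + N, N) <= n < 'C(b.+1 + N, N))%N.
Proof.
move=> N_ge1 n_ge1.
have ex : exists b, ('C(b + N, N) <= n)%N by exists 0%N; rewrite add0n binn.
have bin_ge b : (b < 'C(b + N, N))%N.
  elim: b => [|b IH]; first by rewrite add0n binn.
  rewrite addSn -(prednK N_ge1) binS prednK //.
  have : (0 < 'C(b + N, N.-1))%N by rewrite bin_gt0; lia.
  by move: IH; lia.
have ub b : ('C(b + N, N) <= n)%N -> (b <= n)%N.
  by move/(leq_trans (bin_ge b))/ltnW.
case: (ex_maxnP ex ub) => b le_n maxb; exists b; rewrite le_n /= ltnNge.
by apply/negP => /maxb; rewrite ltnn.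
Qed.

Theorem theorem2p7 (k : closedFieldType) (chark0 : [pchar k] =i pred0)
    (N n : nat) (N_ge1 : (1 <= N)%N) (n_ge1 : (1 <= n)%N) :
  let H := generic_points_ideal k n N in
  forall m : nat, (1 <= m)%N ->
  (alpha (symbolic_power H m))%:R / m%:R
    >= ((alpha H)%:R + N%:R - 1) / N%:R :> rat.
Proof.
move=> H m m_ge1.
have [b /andP[le_n lt_n]] := exists_bin_sandwich N_ge1 n_ge1.
have [f [f_neq0 homf f0]] :
    exists f, [/\ f != 0, f \is (b.+1).-homog &
      forall i, f.@[@generic_point k n N i] = 0].
  by apply: exists_form_through; rewrite -[X in 'C(_, X)](addnK N) bin_sub // leq_addl.
have Hf : H f by move=> i _; apply: point_ideal_homog homf (f0 i).
have [le_alpha _] := alphaP Hf f_neq0 homf.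
(* This provides a nonzero form in the symbolic power, so that [alpha] is attained there. *)
have symfm : symbolic_power H m (f ^+ m).
  apply: ideal_exp_symbolic_power; exists 1%N, (fun=> 1), (fun=> f ^+ m).
  split; last by rewrite big_ord1 mul1r.
  by move=> _; exists (fun=> f); rewrite prodr_const card_ord.
have [_ [F [symF F_neq0 homF]]] :=
  alphaP symfm (expf_neq0 m f_neq0) (dhomogMn m homf).
have := star_bound_generic chark0 N_ge1 le_n F_neq0 homF symF.
set e := alpha (symbolic_power H m) => le_e.
(* From [alpha H <= b + 1] follows [alpha H + N - 1 <= b + N]. *)
have le_aN : ((alpha H + N).-1 * m <= e * N)%N.
  by apply: leq_trans le_e; rewrite mulnC leq_mul2l; apply/orP; right; lia.
rewrite ler_pdivlMr ?ltr0n // mulrAC ler_pdivrMr ?ltr0n //.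
have -> : (alpha H)%:R + N%:R - 1 = ((alpha H + N).-1)%:R :> rat.
  by rewrite -natrD -subn1 natrB // addn_gt0 N_ge1 orbT.
by rewrite -!natrM ler_nat.
Qed.
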